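(* Let $G$ be an interval graph. Then $o(G)=\mathcal{D}$ if and only if $G$ admits a pairing dominating set.
   Context: All graphs are finite and simple; $N[v]$ denotes the closed neighborhood of $v$. An interval graph is the intersection graph of a family of closed intervals of the real line: each vertex corresponds to an interval, and two vertices are adjacent if and only if their intervals intersect. A pairing dominating set of a graph $G=(V,E)$ is a set of pairs of vertices $\{(u_1,v_1),\dots,(u_k,v_k)\}$ of $V$ such that all the vertices appearing in the pairs are distinct and $V=\bigcup_{i=1}^k \left(N[u_i]\cap N[v_i]\right)$. The Maker-Breaker domination game on a graph $G$: two players, Dominator and Staller, alternately claim a not-yet-claimed vertex of $G$. Dominator wins if at some point the vertices she has claimed form a dominating set of $G$. Otherwise, i.e. if Staller manages to claim a vertex and all its neighbors, Staller wins. The graph $G$ has outcome $\mathcal{D}$, written $o(G)=\mathcal{D}$, if Dominator has a winning strategy whoever starts (equivalently, if Dominator has a winning strategy when playing second, since no player benefits from skipping a turn). *)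

(* Defs.v *)
From HB Require Import structures.
From mathcomp Require Import all_boot all_order all_algebra.
From mathcomp Require Import reals.

Set Implicit Arguments.
Unset Strict Implicit.
Unset Printing Implicit Defensive.

Import Order.TTheory GRing.Theory Num.Theory.

(* A finite simple graph is a finite type T of vertices with a symmetric and
   irreflexive adjacency relation e; these two properties are hypotheses of the
   theorem rather than part of the definitions below. *)

Definition interval_graph (R : realType) (T : finType) (e : rel T) : Prop :=
  exists l r : T -> R,
    (forall v, (l v <= r v)%R) /\
    (forall u v, u != v ->
       (e u v <-> exists x : R, x \in `[l u, r u]%R /\ x \in `[l v, r v]%R)).

Definition closed_neigh (T : finType) (e : rel T) (v : T) : {set T} :=
  [set u | (u == v) || e v u].

Definition dominating (T : finType) (e : rel T) (A : {set T}) : Prop :=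
  \bigcup_(u in A) closed_neigh e u = [set: T].

(* The uniqueness condition makes all 2k vertices of the k pairs distinct, the
   two vertices of a same pair included; in particular s has no repeated pair
   and so represents a set of pairs. *)
Definition pairing_dominating_set (T : finType) (e : rel T)
    (s : seq (T * T)) : Prop :=
  uniq (unzip1 s ++ unzip2 s) /\
  \bigcup_(p <- s) (closed_neigh e p.1 :&: closed_neigh e p.2) = [set: T].

Inductive player := Dominator | Staller.

Definition opponent (p : player) : player :=
  if p is Dominator then Staller else Dominator.

(* A play is recorded as the sequence of claimed vertices, in chronological
   order. [mover first i] is the player making move number i (from 0). *)
Definition mover (first : player) (i : nat) : player :=
  if odd i then opponent first else first.

Fixpoint dominator_claims (T : finType) (first : player) (h : seq T) :
    {set T} :=
  if h is v :: h' then
    let D := dominator_claims (opponent first) h' in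
    if first is Dominator then v |: D else D
  else set0.

(* The option type makes strategies exist on the graph without vertices; a legal
   strategy answers None only when no vertex is left (or off actual plays). *)
Definition strategy (T : finType) := seq T -> option T.

Definition legal_strategy (T : finType) (sigma : strategy T) : Prop :=
  forall h : seq T, uniq h -> size h < #|T| ->
    exists2 v, sigma h = Some v & v \notin h.

Definition follows (T : finType) (first : player) (sigma : strategy T)
    (h : seq T) : Prop :=
  forall h1 v h2, h = h1 ++ v :: h2 ->
    mover first (size h1) = Dominator -> sigma h1 = Some v.

(* Plays are continued until every vertex is claimed. This does not affect the
   winner, since Dominator wins as soon as, at some point n of the play, her
   vertices form a dominating set. *)
Definition dominator_winning_strategy (T : finType) (e : rel T)
    (first : player) (sigma : strategy T) : Prop :=
  legal_strategy sigma /\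
  forall h : seq T, uniq h -> size h = #|T| -> follows first sigma h ->
    exists n, dominating e (dominator_claims first (take n h)).

Definition outcome_D (T : finType) (e : rel T) : Prop :=
  forall first : player,
    exists sigma : strategy T, dominator_winning_strategy e first sigma.

(* Main.v *)
Require Import Defs.
From mathcomp Require Import all_boot all_order all_algebra.
From mathcomp Require Import reals.
From mathcomp Require Import fingroup perm boolp zify.

Set Implicit Arguments.
Unset Strict Implicit.
Unset Printing Implicit Defensive.

(* Sort the vertices by right endpoint. Up to supersets, the closed neighborhoods
   are the sets E_p of vertices covering a position p, where every vertex x covers
   a range [l x, r x) of positions. Dominator wants a pairing in which every p is
   covered by both members of some pair. The certificate for Staller is a binary
   tree: a leaf is a position covered by at most one remaining vertex; at an inner
   node Staller claims x, after which two position ranges, to the left of e and to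
   the right of b, are still winning and no remaining vertex touches both of them,
   so that Dominator can spoil only one.

   If there is no pairing on [a, c), such a tree is found by induction. Let Y be
   the vertices covering the first position a, and k the one of Y that ends last.
   For u, v in Y with r u <= r v there is no pairing on [r u, c) without v (add the
   pair (u, v) to it), hence there is a tree there. If the root x of that tree is
   not in Y, then x can be stretched to the left down to a without making a pairing
   possible, and this increases Y; longer vertices only make Staller's task harder.
   Otherwise the root can be taken to be k. Let e be the last position such that
   only k joins e to a range [b, c) with a tree not using k. Then [a, e] has no
   pairing without k, and k is the root of a tree on [a, c). *)

(** * Pairings and obstructions on ranges of positions *)

Definition cov (T : finType) (l r : T -> nat) (x : T) (p : nat) :=
  l x <= p < r x.

Definition matched (T : finType) (l r : T -> nat) (g : T -> T) (J : {set T})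
    (p : nat) : Prop :=
  exists x, [/\ x \in J, g x \in J, g x != x, cov l r x p & cov l r (g x) p].

(** A pairing is encoded as an involution; its fixed points, excluded by [matched], are the unpaired
    vertices. *)
Definition pairable (T : finType) (l r : T -> nat) (J : {set T}) (a c : nat) :=
  exists2 g : T -> T, involutive g &
    forall p, a <= p < c -> matched l r g J p.

Inductive obstruction (T : finType) (l r : T -> nat) : {set T} -> nat -> nat -> Prop :=
| obstruction_leaf (J : {set T}) a c p : a <= p < c ->
    (forall x y, x \in J -> y \in J -> cov l r x p -> cov l r y p -> x = y) ->
    obstruction l r J a c
| obstruction_node (J : {set T}) a c x e b :
    a <= e -> e < b -> b < c -> x \in J -> l x <= e ->
    obstruction l r (J :\ x) a e.+1 -> obstruction l r (J :\ x) b c ->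
    (forall y, y \in J -> cov l r y e -> cov l r y b -> y = x) ->
    obstruction l r J a c.

Section Intervals.

Variable T : finType.
Implicit Types (l r : T -> nat) (J : {set T}).

Lemma obstruction_widen l r J a c a' c' :
  obstruction l r J a c -> a' <= a -> c <= c' -> obstruction l r J a' c'.
Proof.
move=> h; elim: h a' c' =>
  {J a c} [J a c p Hp Hu|J a c x e b ae eb bc xJ lx hA IA hB IB Hc] a' c' Ha Hc'.
  by apply: (obstruction_leaf (p := p)) => //; lia.
apply: (obstruction_node (x := x) (e := e) (b := b)) => //;
  [lia | lia | exact: IA | exact: IB].
Qed.

Lemma obstruction_nonempty l r J a c : obstruction l r J a c -> a < c.
Proof. by case=> *; lia. Qed.

(** Shrinking, deleting or renaming vertices only helps Staller. Injectivity of [f] transports the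
    uniqueness conditions at leaves and crossings. *)
Lemma obstruction_map l r l' r' (f : {perm T}) J J' a c :
  obstruction l r J a c ->
  (forall x p, x \in J' -> a <= p < c -> cov l' r' x p ->
     f x \in J /\ cov l r (f x) p) ->
  obstruction l' r' J' a c.
Proof.
move=> h; elim: h J' =>
  {J a c} [J a c p Hp Hu|J a c x e b ae eb bc xJ lx hA IA hB IB Hc] J' Hf.
  apply: (obstruction_leaf (p := p)) => // x y xJ yJ cx cy; apply: (@perm_inj _ f).
  have [? ?] := Hf x p xJ Hp cx; have [? ?] := Hf y p yJ Hp cy.
  exact: Hu.
pose x' := (f^-1)%g x; have fx' : f x' = x by rewrite permKV.
have [/andP[x'J lx']|Hx'] := boolP ((x' \in J') && (l' x' <= e)).
  apply: (obstruction_node (x := x') (e := e) (b := b)) => //.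
  - apply: IA => y p; rewrite !inE => /andP[yx yJ] Hp cy.
    have [|? ?] := Hf y p yJ _ cy; first lia.
    by split=> //; apply/andP; split=> //; rewrite -fx' (inj_eq perm_inj).
  - apply: IB => y p; rewrite !inE => /andP[yx yJ] Hp cy.
    have [|? ?] := Hf y p yJ _ cy; first lia.
    by split=> //; apply/andP; split=> //; rewrite -fx' (inj_eq perm_inj).
  - move=> y yJ c1 c2; apply: (@perm_inj _ f); rewrite fx'.
    have [|? ?] := Hf y e yJ _ c1; first lia.
    have [|? ?] := Hf y b yJ _ c2; first lia.
    exact: Hc.
(* Here [x'] is outside [J'] or starts after [e], so it covers nothing in [[a, e]] and the left
   subtree alone suffices. *)
apply: (@obstruction_widen _ _ _ a e.+1) => //; last lia.
apply: IA => y p yJ Hp cy; have [|? ?] := Hf y p yJ _ cy; first lia.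
split=> //; rewrite !inE; apply/andP; split=> //; apply/eqP => fy.
have yx : y = x' by apply: (@perm_inj _ f); rewrite fx'.
by move: Hx'; rewrite -yx yJ /=; move: cy; rewrite /cov; lia.
Qed.

Lemma obstruction_sub l r l' r' J J' a c :
  obstruction l r J a c ->
  (forall x p, x \in J' -> a <= p < c -> cov l' r' x p ->
     x \in J /\ cov l r x p) ->
  obstruction l' r' J' a c.
Proof.
by move=> h Hf; apply: (obstruction_map (f := 1%g) h) => x p; rewrite perm1; apply: Hf.
Qed.

Lemma matched_remove l r g J x p : involutive g -> matched l r g J p ->
  matched l r g (J :\ x) p \/
  [/\ x \in J, g x \in J, g x != x, cov l r x p & cov l r (g x) p].
Proof.
move=> gK [y [yJ gyJ gy cy cgy]].
have [yx|yx] := eqVneq y x; first by right; rewrite -yx.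
have [gyx|gyx] := eqVneq (g y) x.
  by right; rewrite -gyx gK; split; rewrite // eq_sym.
by left; exists y; rewrite !inE yx gyx.
Qed.

(** At a node neither range can be paired without [x], so in a pairing on [[a, c)] the partner [g x]
    covers a position of each range. It then covers both [e] and [b], which only [x] may do. *)
Lemma obstruction_not_pairable l r J a c : obstruction l r J a c -> ~ pairable l r J a c.
Proof.
elim=>
  {J a c} [J a c p Hp Hu|J a c x e b ae eb bc xJ lx hA IA hB IB Hc] [g gK Hg].
  have [y [yJ gyJ gy cy cgy]] := Hg p Hp.
  by move/eqP: gy; apply; apply: Hu.
have side a' c' : ~ pairable l r (J :\ x) a' c' -> a <= a' -> c' <= c ->
    exists2 p, a' <= p < c' & [/\ g x \in J, g x != x & cov l r (g x) p].
  move=> np aa cc; apply: contrapT => Hn; apply: np; exists g => // p Hp.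
  have [|//|[? ? ? ? ?]] := @matched_remove l r g J x p gK; first by apply: Hg; lia.
  by case: Hn; exists p.
have [||p1 Hp1 [gJ gx c1]] := side _ _ IA; [lia|lia|].
have [||p2 Hp2 [_ _ c2]] := side _ _ IB; [lia|lia|].
move/eqP: gx; apply; apply: Hc => //; move: c1 c2; rewrite /cov; lia.
Qed.

(** The former partners of [u] and [v] become unpaired, which keeps the map an involution. *)
Definition add_pair (u v : T) (g : T -> T) (x : T) : T :=
  if x == u then v else if x == v then u
  else if (g x == u) || (g x == v) then x else g x.

Lemma add_pairK u v g : involutive g -> involutive (add_pair u v g).
Proof.
move=> gK x; rewrite /add_pair.
have [->|xu] := eqVneq x u; first by rewrite eqxx; case: eqVneq.
have [->|xv] := eqVneq x v; first by rewrite eqxx.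
have [h|h] := boolP ((g x == u) || (g x == v)).
  by rewrite (negPf xu) (negPf xv) h.
by move: h; rewrite negb_or => /andP[/negPf-> /negPf->]; rewrite gK (negPf xu) (negPf xv).
Qed.

Lemma pairable_add l r J a c u v : u \in J -> v \in J -> u != v ->
  cov l r u a -> cov l r v a -> r u <= r v ->
  pairable l r (J :\ v) (r u) c -> pairable l r J a c.
Proof.
rewrite /cov => uJ vJ uv cu cv ruv [g gK Hg].
exists (add_pair u v g); first exact: add_pairK.
move=> p Hp; have [pu|pu] := ltnP p (r u).
  exists u; rewrite /add_pair eqxx; split=> //; first by rewrite eq_sym.
    by rewrite /cov; lia.
  by rewrite /cov; lia.
have [|y [yJ gyJ gy cy cgy]] := Hg p; first lia.
move: yJ gyJ; rewrite !inE => /andP[yv yJ] /andP[gyv gyJ].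
have yu : y != u by apply/eqP=> E; move: cy; rewrite E /cov; lia.
have gyu : g y != u by apply/eqP=> E; move: cgy; rewrite E /cov; lia.
exists y; rewrite /add_pair (negPf yv) (negPf yu) (negPf gyv) (negPf gyu).
by split.
Qed.

End Intervals.

(** * A range of positions has a pairing or an obstruction *)

Section Dichotomy.

Variables (T : finType) (r : T -> nat).
Implicit Types (l : T -> nat) (J : {set T}).

Definition stretch l a (w z : T) := if z == w then a else l z.

Lemma cov_neq l z v p : cov l r z p -> r v <= p -> z != v.
Proof. by case/andP=> _ zp vp; apply: contraTneq zp => ->; rewrite -leqNgt. Qed.

Lemma cov_stretch l a w z p : a <= l w ->
  cov l r z p -> cov (stretch l a w) r z p.
Proof. by rewrite /cov /stretch; case: eqP => [->|]; lia. Qed.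

(* A pairing must give [w] a partner that covers a position of [b, c), hence starts
   after [e]; so stretching [w] to the left does not help. *)
Lemma pairable_stretch l J a c w e b : w \in J -> a <= l w -> l w <= e ->
  e < b -> a <= b ->
  ~ pairable l r (J :\ w) b c ->
  (forall y, y \in J -> cov l r y e -> b < r y -> y = w) ->
  pairable (stretch l a w) r J a c -> pairable l r J a c.
Proof.
move=> wJ aw we eb ab np Hc [g gK Hg].
have same z p : z != w -> cov (stretch l a w) r z p = cov l r z p.
  by rewrite /cov /stretch => /negPf->.
have [gJ gw Hgw] : [/\ g w \in J, g w != w & e < l (g w)].
  apply: contrapT => Hn; apply: np; exists g => // p Hp.
  have [|[y [yJ gyJ gy cy cgy]]|[_ gwJ gw cw cgw]] :=
      @matched_remove _ _ _ _ J w p gK (Hg p _); first lia.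
    move: yJ gyJ; rewrite !inE => /andP[yw yJ] /andP[gyw gyJ].
    by exists y; rewrite !inE yw gyw -!(same _ p).
  case: Hn; split=> //; rewrite ltnNge; apply/negP => le.
  move: cgw; rewrite same // /cov => cgw.
  by move/eqP: gw; apply; apply: Hc => //; rewrite /cov; lia.
exists g => // p Hp; have [|y [yJ gyJ gy cy cgy]] := Hg p; first lia.
exists y; split=> //.
- have [yw|yw] := eqVneq y w; last by rewrite -same.
  move: cy cgy; rewrite yw (same (g w)) // /cov /stretch eqxx; lia.
- have [yw|yw] := eqVneq (g y) w; last by rewrite -same.
  have Ey : y = g w by rewrite -yw gK.
  move: cy cgy; rewrite yw (same y) ?Ey // /cov /stretch eqxx; lia.
Qed.

Lemma obstruction_inv l J a c : obstruction l r J a c ->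
  (exists2 p, a <= p < c & forall x y, x \in J -> y \in J ->
     cov l r x p -> cov l r y p -> x = y) \/
  (exists x e b, [/\ [/\ a <= e, e < b & b < c], x \in J, l x <= e,
     obstruction l r (J :\ x) a e.+1 /\ obstruction l r (J :\ x) b c &
     forall y, y \in J -> cov l r y e -> cov l r y b -> y = x]).
Proof.
case=> {J a c} [J a c p Hp Hu|J a c x e b ae eb bc xJ lx hA hB Hc].
  by left; exists p.
by right; exists x, e, b.
Qed.

Lemma pairable_or_obstruction l J a c : pairable l r J a c \/ obstruction l r J a c.
Proof.
(* The outer induction removes a vertex from [J]; the inner one, on the vertices of [J] missing [a],
   pays for stretching a vertex to [a]. *)
have [n Hn] := ubnP #|J|; elim: n l J a c Hn => // n IHn l J a c Hn.
have [m Hm] := ubnP #|[set z in J | ~~ cov l r z a]|.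
elim: m l Hm => // m IHm l Hm.
have drop x l' a' c' : x \in J -> ~ pairable l' r (J :\ x) a' c' ->
    obstruction l' r (J :\ x) a' c'.
  move=> xJ np; have [|//|//] := IHn l' (J :\ x) a' c'.
  by move: Hn; rewrite (cardsD1 x) xJ; lia.
have [|np] := pselect (pairable l r J a c); [by left|right].
have [ac|ac] := ltnP a c; last first.
  by case: np; exists id => // p Hp; lia.
have tail u v : u \in J -> v \in J -> u != v -> cov l r u a -> cov l r v a ->
    r u <= r v -> obstruction l r (J :\ v) (r u) c.
  move=> uJ vJ uv cu cv ruv; apply: drop => // Hp; apply: np.
  exact: (@pairable_add _ _ _ _ _ _ u v).
apply: contrapT => nobs.
have [u0 [v0 [u0J v0J cu0 cv0 uv0]]] : exists u v, [/\ u \in J, v \in J,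
    cov l r u a, cov l r v a & u != v].
  apply: contrapT => H0; apply: nobs; apply: (obstruction_leaf (p := a)); first lia.
  move=> x y xJ yJ cx cy; apply/eqP/negPn/negP => xy.
  by apply: H0; exists x, y.
have [k kY kmax] := @arg_maxnP _ u0 [pred z | (z \in J) && cov l r z a] r
  (introT andP (conj u0J cu0)).
have {kY}[kJ ck] := andP kY.
have {}kmax z : z \in J -> cov l r z a -> r z <= r k.
  by move=> zJ cz; apply: kmax; apply/andP.
have [w0 w0Y] : exists w0, [pred z | [&& z \in J, cov l r z a & z != k]] w0.
  have [uk|uk] := eqVneq u0 k; last by exists u0; apply/and3P.
  by exists v0; apply/and3P; split=> //; rewrite -uk eq_sym.
have [y yY ymax] := arg_maxnP r w0Y.
have {w0 w0Y yY}[yJ cy yk] := and3P yY.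
have {}ymax z : z \in J -> cov l r z a -> z != k -> r z <= r y.
  by move=> zJ cz zk; apply: ymax; apply/and3P.
have obsy : obstruction l r (J :\ k) (r y) c by apply: tail => //; exact: kmax.
(* [H e] gathers what a node rooted at [k] and cut at [e] needs, apart from the obstruction on
   [[a, e]]. *)
pose H e := exists b, [/\ a <= e, e < b, b < c, obstruction l r (J :\ k) b c &
  forall z, z \in J -> cov l r z e -> cov l r z b -> z = k].
(* The right range starts at [r y]: of the vertices covering [a], only [k] goes on past it. *)
have Ha : H a.
  have yc := obstruction_nonempty obsy; exists (r y); split=> //.
    by case/andP: cy.
  move=> z zJ cz cz'; apply/eqP/negPn/negP => zk.
  by have := ymax z zJ cz zk; case/andP: cz' => _; rewrite ltnNge => /negP.
(* The tree on [[r u, c)] without [v] is turned into a cut [e] for [k] together with its left part.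
   This will refute a pairing on [[a, e]] that avoids [k] and matches [u] with [v]. *)
have inner u v : u \in J -> v \in J -> u != v -> cov l r u a -> cov l r v a ->
    u != k -> v != k -> r u <= r v ->
    exists2 e, H e & obstruction l r (J :\ v :\ k) (r u) e.+1.
  move=> uJ vJ uv cu cv uk vk ruv; have := tail u v uJ vJ uv cu cv ruv.
  have rvy := ymax v vJ cv vk; have ryk := kmax y yJ cy.
  have yc := obstruction_nonempty obsy.
  have kJv : k \in J :\ v by rewrite !inE eq_sym vk.
  case/obstruction_inv=> [[p Hp Hu]|[x [e [b [[ae eb bc] xJ lx [hA hB] Hc]]]]].
    have [rvp|prv] := leqP (r v) p.
      case: nobs; apply: (obstruction_leaf (p := p)).
        by move: Hp cu; rewrite /cov; clear; lia.
      move=> x z xJ zJ cx cz.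
      by apply: Hu; rewrite // !inE ?xJ ?zJ ?(cov_neq cx rvp) ?(cov_neq cz rvp).
    (* A leaf before [r v] is covered by [k], hence by no other vertex of [J :\ v], so the cut can
       be made at [p]. *)
    have ckp : cov l r k p.
      by move: Hp ck cu prv (kmax v vJ cv); rewrite /cov; clear; lia.
    exists p.
      exists (r y); split=> //.
      - by move: Hp cu; rewrite /cov; clear; lia.
      - exact: leq_trans prv rvy.
      - move=> z zJ cz cz'; apply: Hu => //; rewrite !inE zJ andbT.
        exact: cov_neq cz' rvy.
    apply: (obstruction_leaf (p := p)); first by move: Hp; clear; lia.
    move=> x z; rewrite !inE => /and3P[_ xv xJ] /and3P[_ zv zJ].
    by apply: Hu; rewrite !inE ?xv ?zv.
  have ua : a < r u by case/andP: cu.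
  have aE : a <= e by apply: leq_trans ae; apply: ltnW.
  move: xJ; rewrite !inE => /andP[xv xJ].
  have crossP z : z \in J -> cov l r z e -> cov l r z b -> z != x -> z = v.
    move=> zJ c1 c2; apply: contra_neq_eq => zv; apply: Hc => //.
    by rewrite !inE zv.
  have prefix z p : cov l r z a -> a <= p -> p < r z -> cov l r z p.
    by rewrite /cov; clear; lia.
  have crossN z : z != x -> z != v -> z \in J -> cov l r z a -> r z <= b.
    move=> zx zv zJ cz; rewrite leqNgt; apply/negP => bz.
    move/eqP: zv; apply; apply: crossP => //.
      by apply: prefix => //; apply: ltn_trans bz.
    by apply: prefix => //; apply: ltnW; apply: leq_ltn_trans eb.
  have [cx|cx] := boolP (cov l r x a); last first.
    (* The root misses [a]. As [k] is then neither [x] nor [v], it may not join [e] to [b]; so every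
       vertex covering [a] ends by [b]. *)
    have rkb : r k <= b.
      apply: crossN => //; last by rewrite eq_sym.
      by apply: contraNneq cx => <-.
    have rvb : r v <= b := leq_trans rvy (leq_trans ryk rkb).
    have hBx : obstruction l r (J :\ x) b c.
      apply: (obstruction_sub hB) => z p; rewrite !inE => /andP[zx zJ] /andP[bp _] cz.
      by rewrite zx zJ (cov_neq cz (leq_trans rvb bp)).
    (* If [x] also ends by [b], the right subtree is an obstruction for all of [J]; otherwise [x] is
       stretched to [a]. *)
    have [xb|bx] := leqP (r x) b.
      case: nobs; apply: (@obstruction_widen _ _ _ _ b c) => //; last first.
        by apply: ltnW; apply: leq_ltn_trans eb.
      apply: (obstruction_sub hB) => z p zJ /andP[bp _] cz; rewrite !inE zJ.
      by rewrite (cov_neq cz (leq_trans rvb bp)) (cov_neq cz (leq_trans xb bp)).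
    have lax : a < l x.
      by move: cx bx aE eb; rewrite /cov; clear; lia.
    have [|Hp|Ho] := IHm (stretch l a x).
    - rewrite -ltnS; apply: leq_trans Hm; apply: proper_card; apply/properP.
      split; last first.
        exists x; rewrite !inE xJ /= ?negbK //.
        by rewrite /cov /stretch eqxx leqnn; apply: ltn_trans bx; apply: leq_ltn_trans eb.
      apply/subsetP => z; rewrite !inE => /andP[-> /=]; apply: contra.
      by apply: cov_stretch; apply: ltnW.
    - case: np; apply: (pairable_stretch xJ (ltnW lax) lx eb _ _ _ Hp).
      + by apply: ltnW; apply: leq_ltn_trans eb.
      + exact: obstruction_not_pairable hBx.
      + move=> z zJ c1 bz; apply/eqP/negPn/negP => zx.
        have zv : z = v.
          by apply: crossP => //; move: c1 bz eb; rewrite /cov; clear; lia.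
        by move: bz; rewrite zv ltnNge rvb.
    - case: nobs; apply: (obstruction_sub Ho) => z p zJ _ cz; split=> //.
      by apply: cov_stretch => //; apply: ltnW.
  exists e; last first.
    (* The root covers [a] and ends no later than [k], so [k] can take its place. *)
    apply: (obstruction_map (f := tperm x k) hA) => z p.
    rewrite !inE => /and3P[zk zv zJ] /andP[up _] cz.
    have [zx|zx] := eqVneq z x; last first.
      by rewrite tpermD ?zx ?zv ?zJ // eq_sym.
    rewrite zx tpermL -zx eq_sym zk eq_sym vk kJ; split=> //.
    apply: prefix => //; first by apply: leq_trans up; apply: ltnW.
    by apply: leq_trans (kmax z zJ _); [case/andP: cz | rewrite zx].
  have xy : x != k -> r x <= r y by apply: ymax.
  (* The right range for [k] starts at the later of [b] and [r y]; from there on no other vertex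
     covering [a] is left. *)
  have [byy|yb] := leqP b (r y).
    exists (r y); split=> //; first exact: leq_trans eb byy.
    move=> z zJ c1 c2; apply/eqP/negPn/negP => zk.
    have zx : z = x.
      apply/eqP/negPn/negP => zx; move/eqP: (cov_neq c2 rvy); apply.
      by apply: crossP => //; move: c1 c2 eb byy; rewrite /cov; clear; lia.
    by move: zk (cov_neq (v := x) c2); rewrite zx eqxx => xk; move/(_ (xy xk)).
  have far z p : z \in J -> b <= p -> cov l r z p -> z != k -> z != v /\ z != x.
    move=> zJ bp cz zk; have yp := leq_trans (ltnW yb) bp.
    split; first exact: cov_neq cz (leq_trans rvy yp).
    apply/eqP => zx; move: (cov_neq (v := x) cz); rewrite zx eqxx.
    by move/(_ (leq_trans (xy _) yp)); rewrite -zx zk => /(_ isT).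
  exists b; split=> //.
    apply: (obstruction_sub hB) => z p; rewrite !inE => /andP[zk zJ] /andP[bp _] cz.
    by have [-> ->] := far z p zJ bp cz zk.
  move=> z zJ c1 c2; apply/eqP/negPn/negP => zk.
  have [zv zx] := far z b zJ (leqnn b) c2 zk.
  by move/eqP: zv; apply; apply: crossP.
(* Taking the last cut ensures that every cut given by [inner] is at or before [e]. *)
have [||e He emax] := @ex_maxnP (fun e => `[< H e >]) c.
- by exists a; apply/asboolP.
- by move=> e /asboolP[b [_ eb bc _ _]]; apply: ltnW; apply: ltn_trans bc.
have {He}/asboolP[b [ae eb bc hB Hc]] := He.
apply: nobs; apply: (obstruction_node (x := k) (e := e) (b := b)) => //.
  by case/andP: ck => lk _; apply: leq_trans ae.
apply: drop => // -[g gK Hg].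
have [|u [uJ guJ gu cu cgu]] := Hg a; first by rewrite leqnn ltnS.
wlog ruv : u uJ guJ gu cu cgu / r u <= r (g u).
  move=> W; have [?|?] := leqP (r u) (r (g u)); first exact: (W u).
  by apply: (W (g u)); rewrite ?gK // 1?eq_sym // ltnW.
move: (uJ) (guJ); rewrite !inE => /andP[uk uJ'] /andP[guk guJ'].
have [|e' He' hA] := inner u (g u) uJ' guJ' _ cu cgu uk guk ruv.
  by rewrite eq_sym.
have e'e : e' <= e by apply: emax; apply/asboolP.
apply: (@obstruction_not_pairable _ _ _ _ _ _ hA); exists g => // p Hp.
have [|z [zJ gzJ gz cz cgz]] := Hg p.
  by move: cu Hp e'e; rewrite /cov; clear; lia.
have [up _] := andP Hp.
have zu := cov_neq cz up; have gzu := cov_neq cgz up.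
move: zJ gzJ; rewrite !inE => /andP[zk zJ] /andP[gzk gzJ].
exists z; rewrite !inE zk gzk zJ gzJ (inj_eq (inv_inj gK)) zu !andbT; split=> //.
by apply: contra_neq gzu => ->; rewrite gK.
Qed.

End Dichotomy.

Lemma map_uniq_inj (A B : eqType) (f : A -> B) (s : seq A) :
  uniq (map f s) -> {in s &, injective f}.
Proof.
elim: s => //= x s IH /andP[xs us] y z; rewrite !inE.
case/predU1P=> [->|ys] /predU1P[->|zs] // E; last exact: IH.
- by move: xs; rewrite E map_f.
- by move: xs; rewrite -E map_f.
Qed.

(** * Plays and claimed vertices *)

Section Game.

Variable T : finType.
Implicit Types (h : seq T) (first : player) (sigma : strategy T).

Lemma uniq_size_card h : uniq h -> size h = #|T| \/ size h < #|T|.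
Proof.
move=> /card_uniqP <-; have := max_card (mem h).
by rewrite leq_eqVlt => /orP[/eqP|]; [left|right].
Qed.

Lemma mem_full h x : uniq h -> size h = #|T| -> x \in h.
Proof.
move=> u szh; have [| |_ ->] := uniq_min_size (s2 := enum T) u.
- by move=> z _; rewrite mem_enum.
- by rewrite -cardE szh.
- by rewrite mem_enum.
Qed.

Lemma mem_dominator_claims first h x : uniq h ->
  (x \in dominator_claims first h) =
    (x \in h) && (if mover first (index x h) is Dominator then true else false).
Proof.
elim: h first => [|v h IH] first /=; first by rewrite in_set0.
case/andP=> vh uh; rewrite inE (eq_sym v x).
have [E|xv] := eqVneq x v.
  subst v; case: first; rewrite /mover /= ?in_setU1 ?eqxx //.
  by rewrite IH // (negPf vh).
by case: first; rewrite ?in_setU1 ?(negPf xv) /= IH // /mover /=; case: odd.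
Qed.

Lemma dominator_claims_cat first h1 h2 x : uniq (h1 ++ h2) -> x \in h1 ->
  (x \in dominator_claims first (h1 ++ h2)) = (x \in dominator_claims first h1).
Proof.
move=> u xh; have := u; rewrite cat_uniq => /and3P[u1 _ _].
by rewrite !mem_dominator_claims // index_cat mem_cat xh.
Qed.

Lemma dominator_claims_rcons first h x : uniq (rcons h x) ->
  mover first (size h) = Staller -> x \notin dominator_claims first (rcons h x).
Proof.
move=> u mS; rewrite mem_dominator_claims // mem_rcons mem_head /=.
have xh : x \notin h by move: u; rewrite rcons_uniq => /andP[].
by rewrite -cats1 index_cat (negPf xh) /= eqxx addn0 mS.
Qed.

Lemma follows_rcons first sigma h v : follows first sigma h ->
  (mover first (size h) = Dominator -> sigma h = Some v) ->
  follows first sigma (rcons h v).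
Proof.
move=> Hf Hv h1 v' h2; case: (lastP h2) => [|h2' z].
  by rewrite cats1 => /rcons_inj[<- <-].
by rewrite -rcons_cons -rcons_cat => /rcons_inj[E _]; apply: Hf E.
Qed.

(** Winning is judged on full plays, so a play that Staller has already decided must be continued to
    the end. *)
Lemma follows_complete first sigma h : legal_strategy sigma -> uniq h ->
  follows first sigma h ->
  exists h2, [/\ uniq (h ++ h2), size (h ++ h2) = #|T| &
                 follows first sigma (h ++ h2)].
Proof.
move=> leg; have [n] := ubnP (#|T| - size h); elim: n h => // n IH h Hn u Hf.
have [E|lt] := uniq_size_card u.
  by exists [::]; rewrite cats0.
have [v Ev vh] := leg h u lt.
have [|||h2 []] := IH (rcons h v).
- by rewrite size_rcons subnS -ltnS prednK // subn_gt0.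
- by rewrite rcons_uniq vh.
- exact: follows_rcons.
by rewrite cat_rcons; exists (v :: h2).
Qed.

(** * Staller wins from an obstruction *)

Section StallerWins.

Variables (sigma : strategy T) (l r : T -> nat).
Hypothesis leg : legal_strategy sigma.

Definition staller_play h := uniq h /\ follows Staller sigma h.

Definition isolated a c h :=
  exists2 p, a <= p < c & forall x, cov l r x p ->
    x \in h /\ x \notin dominator_claims Staller h.

Lemma staller_play_rcons h x : staller_play h -> ~~ odd (size h) ->
  x \notin h -> staller_play (rcons h x).
Proof.
move=> [u Hf] ev xh; split; first by rewrite rcons_uniq xh.
by apply: follows_rcons => //; rewrite /mover (negPf ev).
Qed.

Lemma not_claimed_cat h1 h2 x : uniq (h1 ++ h2) ->
  x \in h1 /\ x \notin dominator_claims Staller h1 ->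
  x \in h1 ++ h2 /\ x \notin dominator_claims Staller (h1 ++ h2).
Proof.
by move=> u [xh xc]; rewrite dominator_claims_cat // mem_cat xh.
Qed.

Lemma obstruction_isolated J a c : obstruction l r J a c -> forall h,
  staller_play h -> ~~ odd (size h) ->
  (forall x p, a <= p < c -> cov l r x p ->
     (x \in J /\ x \notin h) \/
     (x \in h /\ x \notin dominator_claims Staller h)) ->
  exists2 h', staller_play h' & isolated a c h'.
Proof.
elim=>
  {J a c} [J a c p Hp Hu|J a c x e b ae eb bc xJ lx hA IA hB IB Hc] h plh ev inv.
  have [[x [xJ cx xh]]|none] :=
      pselect (exists x, [/\ x \in J, cov l r x p & x \notin h]).
    have plx := staller_play_rcons plh ev xh; have [ux _] := plx.
    exists (rcons h x) => //; exists p => // y cy.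
    have [[yJ _]|yh] := inv y p Hp cy.
      rewrite (Hu y x) // mem_rcons mem_head; split=> //.
      by apply: dominator_claims_rcons; rewrite // /mover (negPf ev).
    by rewrite -cats1; apply: not_claimed_cat => //; rewrite cats1.
  exists h => //; exists p => // y cy; have [[yJ yh]|//] := inv y p Hp cy.
  by case: none; exists y.
have widen a' c' h' : a <= a' -> c' <= c -> isolated a' c' h' -> isolated a c h'.
  by move=> aa cc [p Hp H]; exists p => //; move: aa cc Hp; clear; lia.
(* If [x] is already claimed, Staller moves directly in the left subtree. *)
have [xh|xh] := boolP (x \in h).
  have [//|//|y p Hp cy|h' plh' is'] := IA h.
    have [|[yJ yh]|] := inv y p _ cy; [by move: Hp eb bc; clear; lia| |by right].
    by left; rewrite !inE yJ yh andbT; split=> //; apply: contraNneq yh => ->.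
  by exists h' => //; apply: (widen a e.+1); last exact: is'; rewrite // (ltn_trans eb).
have plx := staller_play_rcons plh ev xh; have [ux fx] := plx.
have invx y p : a <= p < c -> cov l r y p -> (y \in J :\ x /\ y \notin rcons h x) \/
    (y \in rcons h x /\ y \notin dominator_claims Staller (rcons h x)).
  move=> Hp cy; have [->|yx] := eqVneq y x.
    right; rewrite mem_rcons mem_head; split=> //.
    by apply: dominator_claims_rcons; rewrite // /mover (negPf ev).
  have [[yJ yh]|yh] := inv y p Hp cy.
    by left; rewrite !inE mem_rcons inE negb_or yx yJ yh.
  by right; rewrite -cats1; apply: not_claimed_cat => //; rewrite cats1.
(* If [x] was the last free vertex, Dominator has no reply and Staller owns all that covers [a]. *)
have [E|lt] := uniq_size_card ux.
  exists (rcons h x) => //; exists a; first by move: ae eb bc; clear; lia.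
  move=> y cy; have [||//] := invx y a _ cy; first by move: ae eb bc; clear; lia.
  by case=> _ /negP[]; apply: mem_full.
have [y Ey yh] := leg ux lt.
have ply : staller_play (rcons (rcons h x) y).
  by split; [rewrite rcons_uniq yh | apply: follows_rcons].
have [uy _] := ply.
have evy : ~~ odd (size (rcons (rcons h x) y)) by rewrite !size_rcons /= negbK.
have side a' c' : a <= a' -> c' <= c -> (forall p, a' <= p < c' -> ~~ cov l r y p) ->
    forall z p, a' <= p < c' -> cov l r z p ->
    (z \in J :\ x /\ z \notin rcons (rcons h x) y) \/
    (z \in rcons (rcons h x) y /\
     z \notin dominator_claims Staller (rcons (rcons h x) y)).
  move=> aa cc ny z p Hp cz.
  have [||zh] := invx z p _ cz; first by move: aa cc Hp; clear; lia.
    case=> zJ zh; left; split=> //; rewrite mem_rcons inE negb_or zh andbT.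
    by apply: contraTneq cz => ->; apply: ny.
  by right; rewrite -cats1; apply: not_claimed_cat => //; rewrite cats1.
(* Staller continues in a range that the reply [y] does not touch. *)
have [[p Hp cp]|noA] := pselect (exists2 p, a <= p < e.+1 & cov l r y p).
  have [|h' plh' is'] := IB _ ply evy.
    apply: side => //; first by move: ae eb; clear; lia.
    move=> p' Hp'; apply/negP => cp'; move/negP: yh; apply.
    have [|[yJ _]|[yx _]//] := invx y p _ cp; first by move: Hp eb bc; clear; lia.
    have -> : y = x; last by rewrite mem_rcons mem_head.
    move: yJ; rewrite !inE => /andP[_ yJ].
    by apply: Hc => //; move: cp cp' Hp Hp' eb; rewrite /cov; clear; lia.
  by exists h' => //; apply: (widen b c) is' => //; move: ae eb; clear; lia.
have [|h' plh' is'] := IA _ ply evy.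
  apply: side => //; first by apply: ltn_trans bc.
  by move=> p Hp; apply/negP => cp; apply: noA; exists p.
by exists h' => //; apply: (widen a e.+1) is' => //; apply: ltn_trans bc.
Qed.

End StallerWins.

(** * Dominator's pairing strategy *)

Section PairingStrategy.

Variable s : seq (T * T).
Hypothesis us : uniq (unzip1 s ++ unzip2 s).

Definition mate x y := ((x, y) \in s) || ((y, x) \in s).

Lemma mate_inj x y z : mate x y -> mate x z -> y = z.
Proof.
move: us; rewrite cat_uniq => /and3P[u1 /hasPn dis u2].
have inj1 : {in s &, injective fst} by apply: map_uniq_inj.
have inj2 : {in s &, injective snd} by apply: map_uniq_inj.
have dis12 a b c : (a, b) \in s -> (c, a) \in s -> False.
  move=> ab ca; have /negP[] := dis a (map_f snd ca).
  exact: (map_f fst ab).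
rewrite /mate => /orP[xy|yx] /orP[xz|zx].
- by have /(_ erefl)[] := inj1 _ _ xy xz.
- by case: (dis12 _ _ _ xy zx).
- by case: (dis12 _ _ _ xz yx).
- by have /(_ erefl)[] := inj2 _ _ yx zx.
Qed.

Lemma mate_neq x y : mate x y -> x != y.
Proof.
move: us; rewrite cat_uniq => /and3P[_ /hasPn dis _] m; apply/eqP => xy.
have xx : (x, x) \in s by move: m; rewrite /mate -xy orbb.
by have /negP[] := dis x (map_f snd xx); apply: (map_f fst xx).
Qed.

(** On the empty play [last v h] is [v] itself, which is never its own mate, so an arbitrary vertex
    is chosen. *)
Definition mate_strategy : strategy T := fun h =>
  if [pick v | (v \notin h) && mate (last v h) v] is Some v then Some v
  else [pick v | v \notin h].

Lemma mate_strategy_legal : legal_strategy mate_strategy.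
Proof.
move=> h u lt; rewrite /mate_strategy; case: pickP => [v /andP[vh _]|_].
  by exists v.
case: pickP => [v vh|none]; first by exists v.
suff : #|T| <= size h by rewrite leqNgt lt.
rewrite cardE; apply: uniq_leq_size (enum_uniq _) _ => x _.
exact: (negbFE (none x)).
Qed.

(** If Staller takes the earlier of the two, the other is still free and is Dominator's next
    move. *)
Lemma mate_strategy_claims first h x y : uniq h -> size h = #|T| ->
  follows first mate_strategy h -> mate x y -> x != y ->
  (x \in dominator_claims first h) || (y \in dominator_claims first h).
Proof.
move=> u szh Hf; have full z : z \in h by apply: mem_full.
wlog ixy : x y / index x h < index y h => [W|] xy nxy.
  have [lt|gt|E] := ltngtP (index x h) (index y h); first exact: W.
    by rewrite orbC; apply: W; rewrite // 1?eq_sym // /mate orbC.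
  by case/eqP: nxy; rewrite -(nth_index x (full x)) E nth_index.
rewrite !mem_dominator_claims // !full /=.
case mx : (mover first (index x h)) => //=.
have lx : index x h < size h by rewrite index_mem.
pose h1 := take (index x h) h; pose h2 := drop (index x h).+1 h.
have Eh : h = rcons h1 x ++ h2.
  by rewrite cat_rcons -{1}(nth_index x (full x)) -drop_nth // cat_take_drop.
have yh1 : y \notin rcons h1 x.
  rewrite mem_rcons inE eq_sym (negPf nxy) /= /h1 in_take //.
  by rewrite -leqNgt ltnW.
have szh1 : size h1 = index x h by rewrite size_takel // ltnW.
case Eh2 : h2 => [|v h3].
  by move: (full y); rewrite Eh Eh2 cats0 (negPf yh1).
have mv : mover first (size (rcons h1 x)) = Dominator.
  by move: mx; rewrite size_rcons szh1 /mover /=; case: odd; case: (first).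
have := Hf (rcons h1 x) v h3; rewrite -Eh2 => /(_ Eh mv).
rewrite /mate_strategy; case: pickP => [z /andP[zh]|/(_ y)]; last first.
  by rewrite last_rcons yh1 xy.
rewrite last_rcons => /(mate_inj xy) <- [yv].
by rewrite Eh Eh2 -yv index_cat (negPf yh1) /= eqxx addn0 mv.
Qed.

End PairingStrategy.

End Game.

(** * From real intervals to ranges of positions *)

Section Graph.

Import Order.POrderTheory Order.TotalTheory.

Variables (R : realType) (T : finType) (e : rel T) (lo hi : T -> R).
Hypothesis lohi : forall v, (lo v <= hi v)%R.
Hypothesis adj : forall u v, u != v ->
  (e u v <-> exists x : R, x \in `[lo u, hi u]%R /\ x \in `[lo v, hi v]%R).

Lemma mem_closed_neigh u v :
  (u \in closed_neigh e v) = (lo u <= hi v)%R && (lo v <= hi u)%R.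
Proof.
rewrite inE; have [->|uv] /= := eqVneq u v; first by rewrite lohi.
rewrite eq_sym in uv; apply/idP/andP.
  case/(adj uv) => x []; rewrite !in_itv /= => /andP[a1 a2] /andP[a3 a4].
  by split; [apply: le_trans a2 | apply: le_trans a4].
case=> h1 h2; apply/(adj uv); exists (Order.max (lo u) (lo v)).
by rewrite !in_itv /= !le_max !ge_max !lexx ?orbT /= h1 h2 !lohi.
Qed.

Lemma closed_neighC u v : (u \in closed_neigh e v) = (v \in closed_neigh e u).
Proof. by rewrite !mem_closed_neigh andbC. Qed.

Definition by_hi := sort (fun u v => (hi u <= hi v)%R) (enum T).
(** Positions are indices in [by_hi]. If no interval begins after [u] ends, [find] returns the size,
    so [u] covers all positions from [start u] on. *)
Definition start u := find (fun v => (lo u <= hi v)%R) by_hi.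
Definition stop u := find (fun v => (hi u < lo v)%R) by_hi.

Lemma mem_by_hi v : v \in by_hi.
Proof. by rewrite mem_sort mem_enum. Qed.

Lemma hi_nth x0 i j : i <= j -> j < size by_hi ->
  (hi (nth x0 by_hi i) <= hi (nth x0 by_hi j))%R.
Proof.
move=> ij js; apply: (@sorted_leq_nth _ (fun u v => (hi u <= hi v)%R)) => //.
- by move=> y x z; apply: le_trans.
- by apply: sort_sorted => x y; apply: le_total.
- by rewrite inE; apply: leq_ltn_trans js.
Qed.

(** The converse can fail: an interval listed before [v] may lie wholly to the right of [u] although
    [u] meets [v]. *)
Lemma cov_index u v :
  cov start stop u (index v by_hi) -> u \in closed_neigh e v.
Proof.
have vs : index v by_hi < size by_hi by rewrite index_mem mem_by_hi.
case/andP=> su us; rewrite mem_closed_neigh; apply/andP; split.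
  have ss : start u < size by_hi by apply: leq_ltn_trans vs.
  have := @nth_find _ v (fun v => (lo u <= hi v)%R) by_hi; rewrite has_find => /(_ ss) h1.
  apply: le_trans h1 _.
  by rewrite -[X in (_ <= hi X)%R](nth_index v (mem_by_hi v)); apply: hi_nth.
have := @before_find _ v (fun v => (hi u < lo v)%R) by_hi _ us.
by rewrite nth_index ?mem_by_hi // => /negbT; rewrite -leNgt.
Qed.

(* The set of intervals covering position [j] consists of those meeting every
   [v] placed at or before [j] on the right, and it is determined by the [v]
   among these with the largest left endpoint. *)
Lemma closed_neigh_cov j : j < size by_hi ->
  exists v, forall u, u \in closed_neigh e v -> cov start stop u j.
Proof.
move=> js; have x0 : T by case: by_hi js.
pose F (i : 'I_(size by_hi)) := lo (nth x0 by_hi i).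
have [i ij imax] :=
  @arg_maxP _ _ _ (Ordinal js) (fun i => i <= j) F (leqnn j).
exists (nth x0 by_hi i) => u; rewrite mem_closed_neigh => /andP[h1 h2].
apply/andP; split.
  rewrite leqNgt; apply/negP => /(before_find x0) /negP[].
  by apply: le_trans h1 _; apply: hi_nth.
rewrite ltnNge; apply/negP => sj; have ss := leq_ltn_trans sj js.
have := @nth_find _ x0 (fun v => (hi u < lo v)%R) by_hi; rewrite has_find => /(_ ss).
apply/negP; rewrite -leNgt.
apply: le_trans h2.
exact: (imax (Ordinal ss)).
Qed.

Lemma pairable_pairing : pairable start stop [set: T] 0 (size by_hi) ->
  exists s, pairing_dominating_set e s.
Proof.
case=> g gK Hg.
(* Each two-element orbit of [g] is listed once, from its vertex of smaller rank; fixed points drop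
   out. *)
pose below := [pred x | enum_rank x < enum_rank (g x)].
pose A := [seq x <- enum T | below x].
have uA : uniq A by rewrite filter_uniq ?enum_uniq.
exists [seq (x, g x) | x <- A].
have E1 : unzip1 [seq (x, g x) | x <- A] = A.
  by rewrite /unzip1 -map_comp map_id_in.
have E2 : unzip2 [seq (x, g x) | x <- A] = map g A by rewrite /unzip2 -map_comp.
split.
  rewrite E1 E2 cat_uniq uA map_inj_uniq ?uA ?andbT; last exact: inv_inj.
  apply/hasPn => _ /mapP[x xA ->]; apply/negP => gxA; move: xA gxA.
  rewrite !mem_filter /= gK => /andP[h _] /andP[h' _].
  by have := ltn_trans h h'; rewrite ltnn.
apply/setP => w; rewrite inE.
have [|x [_ _ gx cx cgx]] := Hg (index w by_hi).
  by rewrite leq0n index_mem mem_by_hi.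
wlog lt : x gx cx cgx / below x => [W|].
  have [lt|gt|E] := ltngtP (enum_rank x) (enum_rank (g x)); first exact: W lt.
    by apply: (W (g x)); rewrite /= ?gK // eq_sym.
  by move/eqP: gx; case; apply: enum_rank_inj; apply: val_inj.
rewrite bigcup_seq; apply/bigcupP; exists (x, g x).
  by apply: map_f; rewrite mem_filter lt mem_enum.
by rewrite inE /= !(closed_neighC w) !cov_index.
Qed.

End Graph.

Theorem theorem4p6 (R : realType) (T : finType) (e : rel T)
    (e_sym : symmetric e) (e_irr : irreflexive e)
    (e_int : interval_graph R e) :
  outcome_D e <-> exists s : seq (T * T), pairing_dominating_set e s.
Proof.
split=> [win|[s [us dom]] first]; last first.
  exists (mate_strategy s); split=> [|h u szh Hf]; first exact: mate_strategy_legal.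
  exists (size h); rewrite take_size; apply/setP => w; rewrite inE.
  have := in_setT w; rewrite -dom bigcup_seq => /bigcupP[[x y] xys].
  rewrite inE => /andP[wx wy].
  have mxy : mate s x y by rewrite /mate xys.
  have xy : x != y by exact: (mate_neq us mxy).
  have /orP[xD|yD] := mate_strategy_claims us u szh Hf mxy xy.
    by apply/bigcupP; exists x.
  by apply/bigcupP; exists y.
have [l [r [lr adj]]] := e_int.
have [|ob] := pairable_or_obstruction (stop l r) (start l r) [set: T] 0 (size (by_hi r)).
  exact: pairable_pairing.
(* Staller, moving first, beats [sigma]: the position isolated in the play contains a whole closed
   neighborhood, so no later move can dominate its center. *)
have [sigma [leg wins]] := win Staller.
have [|||h [u Hf] [p Hp iso]] := obstruction_isolated leg ob (h := [::]).
- by split=> // -[].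
- by [].
- by left; rewrite inE.
have [h2 [uh sh fh]] := follows_complete leg u Hf.
have [n] := wins _ uh sh fh.
have [v Hv] := closed_neigh_cov lr adj (andP Hp).2.
move/setP/(_ v); rewrite inE => /bigcupP[x xD vx].
have xv : x \in closed_neigh e v by rewrite (closed_neighC lr adj).
have /(not_claimed_cat uh)[_ /negP[]] := iso x (Hv x xv).
have ut : uniq (take n (h ++ h2) ++ drop n (h ++ h2)) by rewrite cat_take_drop.
rewrite -(cat_take_drop n (h ++ h2)) dominator_claims_cat //.
by move: xD; rewrite mem_dominator_claims ?take_uniq // => /andP[].
Qed.
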